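(* Let $\mathcal{L}$ be a lattice-oriented signature and let $\mathsf{K}$ be any class of $\mathcal{L}$-lattices. Then there is a one-to-one correspondence between the members of $m\mathsf{K}$ and the ordered pairs $\langle\mathbf{A},\mathbf{A}_0\rangle$ where $\mathbf{A}\in\mathsf{K}$ and $\mathbf{A}_0$ is a relatively complete subalgebra of $\mathbf{A}$, implemented by the maps $\langle\mathbf{A},\Box,\Diamond\rangle\mapsto\langle\mathbf{A},\Box\mathbf{A}\rangle$ and $\langle\mathbf{A},\mathbf{A}_0\rangle\mapsto\langle\mathbf{A},\Box_0,\Diamond_0\rangle$. Here $\Box\mathbf{A}$ is the subalgebra of $\mathbf{A}$ with universe $\{\Box a\mid a\in A\}$, and $\Box_0 a:=\max\{b\in A_0\mid b\le a\}$, $\Diamond_0 a:=\min\{b\in A_0\mid a\le b\}$ for $a\in A$.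
   Context: A signature $\mathcal{L}$ is lattice-oriented if its set of binary operation symbols contains distinct symbols $\land$ and $\lor$. An $\mathcal{L}$-lattice is an algebra of signature $\mathcal{L}$ whose $\{\land,\lor\}$-reduct is a lattice, with order $x\le y$ iff $x\land y=x$. A subalgebra $\mathbf{A}_0$ of $\mathbf{A}$ is relatively complete if for every $a\in A$ the set $\{b\in A_0\mid b\le a\}$ has a maximum and $\{b\in A_0\mid a\le b\}$ has a minimum. An m-$\mathcal{L}$-lattice is a structure $\langle\mathbf{A},\Box,\Diamond\rangle$ where $\mathbf{A}$ is an $\mathcal{L}$-lattice and $\Box,\Diamond$ are unary operations satisfying $\Box x\land x\approx\Box x$, $\Diamond x\lor x\approx \Diamond x$, $\Box(x\land y)\approx\Box x\land\Box y$, $\Diamond(x\lor y)\approx\Diamond x\lor\Diamond y$, $\Box\Diamond x\approx\Diamond x$, $\Diamond\Box x\approx\Box x$, and, for every $n$-ary $\star\in\mathcal{L}$, $\Box(\star(\Box x_1,\dots,\Box x_n))\approx\star(\Box x_1,\dots,\Box x_n)$. For a class $\mathsf{K}$ of $\mathcal{L}$-lattices, $m\mathsf{K}$ denotes the class of all m-$\mathcal{L}$-lattices $\langle\mathbf{A},\Box,\Diamond\rangle$ with $\mathbf{A}\in\mathsf{K}$. *)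

(* Defs.v *)
From mathcomp Require Import all_boot.
From mathcomp Require Import boolp classical_sets functions.

Set Implicit Arguments.
Unset Strict Implicit.
Unset Printing Implicit Defensive.

Local Open Scope classical_set_scope.

(* [sym n] is the type of the n-ary operation symbols. *)
Record signature := Signature { sym :> nat -> Type }.

Record lattice_signature := LatticeSignature {
  lsig :> signature;
  meet_sym : lsig 2;
  join_sym : lsig 2;
  meet_neq_join : meet_sym <> join_sym
}.

Record algebra (S : signature) := Algebra {
  carrier :> Type;
  op : forall n : nat, S n -> n.-tuple carrier -> carrier
}.

Definition meet (L : lattice_signature) (A : algebra L) (x y : A) : A :=
  op (meet_sym L) [tuple x; y].

Definition join (L : lattice_signature) (A : algebra L) (x y : A) : A :=
  op (join_sym L) [tuple x; y].

Record is_lattice (L : lattice_signature) (A : algebra L) : Prop := IsLattice {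
  meetC : commutative (@meet L A);
  joinC : commutative (@join L A);
  meetA : associative (@meet L A);
  joinA : associative (@join L A);
  meetKU : forall x y : A, meet x (join x y) = x;
  joinKI : forall x y : A, join x (meet x y) = x
}.

Record lattice_algebra (L : lattice_signature) := LatticeAlgebra {
  lalg :> algebra L;
  lalgP : is_lattice lalg
}.

Definition le (L : lattice_signature) (A : algebra L) (x y : A) : Prop :=
  meet x y = x.

Definition is_max (L : lattice_signature) (A : algebra L) (B : set A) (m : A)
  : Prop := B m /\ forall b : A, B b -> le b m.

Definition is_min (L : lattice_signature) (A : algebra L) (B : set A) (m : A)
  : Prop := B m /\ forall b : A, B b -> le m b.

(* Subalgebras are identified with their universes. *)
Definition subalgebra (S : signature) (A : algebra S) (A0 : set A) : Prop :=
  forall (n : nat) (s : S n) (t : n.-tuple A),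
    (forall i : 'I_n, A0 (tnth t i)) -> A0 (op s t).

Definition lower (L : lattice_signature) (A : algebra L) (A0 : set A) (a : A)
  : set A := [set b | A0 b /\ le b a].

Definition upper (L : lattice_signature) (A : algebra L) (A0 : set A) (a : A)
  : set A := [set b | A0 b /\ le a b].

Definition relatively_complete (L : lattice_signature) (A : algebra L)
    (A0 : set A) : Prop :=
  forall a : A, (exists m : A, is_max (lower A0 a) m) /\
                (exists m : A, is_min (upper A0 a) m).

Record modal_structure (L : lattice_signature) := ModalStructure {
  mbase : lattice_algebra L;
  box : mbase -> mbase;
  dia : mbase -> mbase
}.

Record is_mlattice (L : lattice_signature) (M : modal_structure L) : Prop :=
  IsMLattice {
    box_le : forall x : mbase M, meet (box x) x = box x;
    dia_ge : forall x : mbase M, join (dia x) x = dia x;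
    box_meet : forall x y : mbase M, box (meet x y) = meet (box x) (box y);
    dia_join : forall x y : mbase M, dia (join x y) = join (dia x) (dia y);
    box_dia : forall x : mbase M, box (dia x) = dia x;
    dia_box : forall x : mbase M, dia (box x) = box x;
    box_op : forall (n : nat) (s : L n) (t : n.-tuple (mbase M)),
      box (op s (map_tuple (@box L M) t)) = op s (map_tuple (@box L M) t)
  }.

Definition mclass (L : lattice_signature) (K : set (lattice_algebra L))
  : set (modal_structure L) := [set M | K (mbase M) /\ is_mlattice M].

Record subset_pair (L : lattice_signature) := SubsetPair {
  pbase : lattice_algebra L;
  psub : set pbase
}.
Arguments psub {L} _ _.

Definition rc_pairs (L : lattice_signature) (K : set (lattice_algebra L))
  : set (subset_pair L) :=
  [set P | [/\ K (pbase P), subalgebra (psub P) & relatively_complete (psub P)]].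

(* An element satisfying P; the default d is returned only when there is none. *)
Definition choose_or (T : Type) (d : T) (P : set T) : T :=
  if pselect (exists x : T, P x) is left h then projT1 (cid h) else d.

(* On relatively complete subsets the extremum exists and is unique, so the
   default value a plays no role there. *)
Definition box0 (L : lattice_signature) (A : algebra L) (A0 : set A) (a : A)
  : A := choose_or a (is_max (lower A0 a)).

Definition dia0 (L : lattice_signature) (A : algebra L) (A0 : set A) (a : A)
  : A := choose_or a (is_min (upper A0 a)).

Definition to_pair (L : lattice_signature) (M : modal_structure L)
  : subset_pair L := @SubsetPair L (mbase M) (range (@box L M)).

Definition of_pair (L : lattice_signature) (P : subset_pair L)
  : modal_structure L :=
  @ModalStructure L (pbase P) (box0 (psub P)) (dia0 (psub P)).

(* Main.v *)
Require Import Defs.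
From mathcomp Require Import all_boot.
From mathcomp Require Import boolp classical_sets functions.

(** In an m-lattice, [box x] and [dia x] are the greatest element below [x] and
    the least element above [x] in the range of [box], since [box] and [dia] are
    monotone and both fix this range pointwise; so the range determines both
    operators. Conversely, for a relatively complete subalgebra the operators
    max/min fix exactly the elements of the subalgebra, and the m-lattice
    identities reduce to the extremal properties of max and min together with
    closure under the operations. *)

Set Implicit Arguments.
Unset Strict Implicit.
Unset Printing Implicit Defensive.

Local Open Scope classical_set_scope.

Lemma choose_orP (T : Type) (d : T) (P : set T) :
  (exists x, P x) -> P (choose_or d P).
Proof.
by move=> exP; rewrite /choose_or; case: pselect => // h; case: (cid h).
Qed.

(** Phrased with relative inverses so that the same four facts, with [f] and [g] exchanged, yield
    both bijections. *)
Lemma set_bij_can (T U : Type) (A : set T) (B : set U) (f : T -> U) (g : U -> T) :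
  (forall x, A x -> B (f x)) -> (forall y, B y -> A (g y)) ->
  (forall x, A x -> g (f x) = x) -> (forall y, B y -> f (g y) = y) ->
  set_bij A B f.
Proof.
move=> fAB gBA fK gK; split=> //.
- move=> x y; rewrite !inE => Ax Ay fxy.
  by rewrite -(fK _ Ax) fxy fK.
- by move=> y By; exists (g y); [exact: gBA | exact: gK].
Qed.

Section LatticeOrder.
Variables (L : lattice_signature) (A : lattice_algebra L).
Implicit Types (x y z a : A) (B : set A).

Let AP : is_lattice A := lalgP A.

(** Each direction is one absorption law. This links [le], defined by meets, to the join identities
    for [dia]. *)
Lemma le_joinE x y : le x y <-> join y x = y.
Proof.
split=> [xy|yx].
  by rewrite -[X in join y X]xy (meetC AP) (joinKI AP).
by rewrite /le -yx (joinC AP) (meetKU AP).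
Qed.

(** Idempotence of [meet] is not an axiom; it comes from both absorption laws, on expanding the
    second [x] to [join x (meet x x)]. *)
Lemma le_refl x : le x x.
Proof. by rewrite /le -[X in meet x X](joinKI AP x x) (meetKU AP). Qed.

Lemma le_anti x y : le x y -> le y x -> x = y.
Proof. by move=> xy yx; rewrite -xy (meetC AP). Qed.

Lemma le_trans y x z : le x y -> le y z -> le x z.
Proof. by rewrite /le => xy yz; rewrite -xy -(meetA AP) yz. Qed.

Lemma le_meetl x y : le (meet x y) x.
Proof. by rewrite /le (meetC AP) (meetA AP) (le_refl x). Qed.

Lemma le_meetr x y : le (meet x y) y.
Proof. by rewrite (meetC AP); exact: le_meetl. Qed.

Lemma le_meet z x y : le z x -> le z y -> le z (meet x y).
Proof. by rewrite /le (meetA AP) => ->. Qed.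

Lemma le_joinl x y : le x (join x y).
Proof. exact: meetKU. Qed.

Lemma le_joinr x y : le y (join x y).
Proof. by rewrite (joinC AP); exact: le_joinl. Qed.

Lemma join_le z x y : le x z -> le y z -> le (join x y) z.
Proof. by rewrite !le_joinE (joinA AP) => ->. Qed.

Lemma is_max_uniq B x y : is_max B x -> is_max B y -> x = y.
Proof. by move=> [Bx xP] [By yP]; apply: le_anti; [exact: yP | exact: xP]. Qed.

Lemma is_min_uniq B x y : is_min B x -> is_min B y -> x = y.
Proof. by move=> [Bx xP] [By yP]; apply: le_anti; [exact: xP | exact: yP]. Qed.

(** Once a maximum exists, [choose_or] returns a maximum rather than its default, and maxima are
    unique. *)
Lemma box0_max B a x : is_max (lower B a) x -> box0 B a = x.
Proof. by move=> xP; apply: is_max_uniq (xP); apply: choose_orP; exists x. Qed.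

Lemma dia0_min B a x : is_min (upper B a) x -> dia0 B a = x.
Proof. by move=> xP; apply: is_min_uniq (xP); apply: choose_orP; exists x. Qed.

Lemma subalgebra_op2 (A0 : set A) (s : L 2) x y :
  subalgebra A0 -> A0 x -> A0 y -> A0 (op s [tuple x; y]).
Proof.
move=> subA0 A0x A0y; apply: subA0 => i.
by rewrite (tnth_nth x); case: i => [[|[|m]] ltm2].
Qed.

Section RelativelyComplete.
Variable A0 : set A.
Hypotheses (subA0 : subalgebra A0) (rcA0 : relatively_complete A0).

Lemma box0P a : is_max (lower A0 a) (box0 A0 a).
Proof. exact: choose_orP (rcA0 a).1. Qed.

Lemma dia0P a : is_min (upper A0 a) (dia0 A0 a).
Proof. exact: choose_orP (rcA0 a).2. Qed.

Lemma box0_in a : A0 (box0 A0 a).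
Proof. by case: (box0P a) => -[]. Qed.

Lemma box0_le a : le (box0 A0 a) a.
Proof. by case: (box0P a) => -[]. Qed.

Lemma box0_greatest b a : A0 b -> le b a -> le b (box0 A0 a).
Proof. by move=> A0b ba; apply: (box0P a).2. Qed.

Lemma dia0_in a : A0 (dia0 A0 a).
Proof. by case: (dia0P a) => -[]. Qed.

Lemma dia0_ge a : le a (dia0 A0 a).
Proof. by case: (dia0P a) => -[]. Qed.

Lemma dia0_least b a : A0 b -> le a b -> le (dia0 A0 a) b.
Proof. by move=> A0b ab; apply: (dia0P a).2. Qed.

Lemma box0_id a : A0 a -> box0 A0 a = a.
Proof.
move=> A0a; apply: le_anti; first exact: box0_le.
exact: box0_greatest (le_refl a).
Qed.

Lemma dia0_id a : A0 a -> dia0 A0 a = a.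
Proof.
move=> A0a; apply: le_anti; last exact: dia0_ge.
exact: dia0_least (le_refl a).
Qed.

Lemma range_box0 : range (box0 A0) = A0.
Proof.
apply/seteqP; split=> [_ [a _ <-]|a A0a]; first exact: box0_in.
by exists a => //; exact: box0_id.
Qed.

(** One inequality is monotonicity of [box0]; for the other, closure under [meet] puts the
    right-hand side in [A0], and it lies below [meet x y]. *)
Lemma box0_meet x y : box0 A0 (meet x y) = meet (box0 A0 x) (box0 A0 y).
Proof.
apply: le_anti.
- have mxy := box0_le (meet x y).
  apply: le_meet; apply: box0_greatest (box0_in _) _.
    exact: le_trans mxy (le_meetl _ _).
  exact: le_trans mxy (le_meetr _ _).
- apply: box0_greatest.
    by apply: subalgebra_op2 => //; exact: box0_in.
  apply: le_meet.
    exact: le_trans (le_meetl _ _) (box0_le x).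
  exact: le_trans (le_meetr _ _) (box0_le y).
Qed.

Lemma dia0_join x y : dia0 A0 (join x y) = join (dia0 A0 x) (dia0 A0 y).
Proof.
apply: le_anti.
- apply: dia0_least.
    by apply: subalgebra_op2 => //; exact: dia0_in.
  apply: join_le.
    exact: le_trans (dia0_ge x) (le_joinl _ _).
  exact: le_trans (dia0_ge y) (le_joinr _ _).
- have jxy := dia0_ge (join x y).
  apply: join_le; apply: dia0_least (dia0_in _) _.
    exact: le_trans (le_joinl _ _) jxy.
  exact: le_trans (le_joinr _ _) jxy.
Qed.

Lemma is_mlattice_box0_dia0 :
  is_mlattice (@ModalStructure L A (box0 A0) (dia0 A0)).
Proof.
split=> /=.
- exact: box0_le.
- by move=> x; apply/le_joinE/dia0_ge.
- exact: box0_meet.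
- exact: dia0_join.
- by move=> x; exact/box0_id/dia0_in.
- by move=> x; exact/dia0_id/box0_in.
(* An operation applied to values of [box0] stays in [A0], where [box0] is the identity. *)
- move=> n s t; apply/box0_id/subA0 => i.
  by rewrite tnth_map; exact: box0_in.
Qed.

End RelativelyComplete.
End LatticeOrder.

Section MLattice.
Variables (L : lattice_signature) (M : modal_structure L).
Hypothesis mM : is_mlattice M.

(** [box x] equals [dia (box x)], and values of [dia] are fixed by [box]. *)
Lemma box_idem x : box (box x) = box x :> mbase M.
Proof. by rewrite -(dia_box mM x) (box_dia mM). Qed.

Lemma box_is_max a : is_max (lower (range (@box L M)) a) (box a).
Proof.
split; first by split; [exists a | exact: (box_le mM)].
move=> _ [[c _ <-] ca].
(* Monotonicity: with [box c] read as [box (box c)], [box_meet] reduces the goal to the image of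
   [ca] under [box]. *)
by rewrite /le -{1}(box_idem c) -(box_meet mM) ca box_idem.
Qed.

Lemma dia_is_min a : is_min (upper (range (@box L M)) a) (dia a).
Proof.
split.
  (* [dia a] is its own preimage under [box]. *)
  split; first by exists (dia a) => //; exact: (box_dia mM).
  exact/le_joinE/(dia_ge mM).
move=> _ [[c _ <-] /le_joinE ac]; apply/le_joinE.
by rewrite -{1}(dia_box mM c) -(dia_join mM) ac (dia_box mM).
Qed.

Lemma subalgebra_range_box : subalgebra (range (@box L M)).
Proof.
move=> n s t tP; exists (op s t) => //.
(* Entries of [t] are values of the idempotent [box], so [t] is its own image, the form that
   [box_op] requires. *)
suff {1 2}-> : t = map_tuple (@box L M) t by exact: (box_op mM).
apply: eq_from_tnth => i; rewrite tnth_map.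
by have [c _ <-] := tP i; rewrite box_idem.
Qed.

Lemma relatively_complete_range_box : relatively_complete (range (@box L M)).
Proof.
by move=> a; split; [exists (box a); exact: box_is_max
                    |exists (dia a); exact: dia_is_min].
Qed.

(** The base algebra is untouched, so only the two operators are compared, pointwise, by uniqueness
    of extrema. *)
Lemma to_pairK : of_pair (to_pair M) = M.
Proof.
rewrite /of_pair /=.
have -> : box0 (range (@box L M)) = @box L M.
  by apply: funext => a; exact/box0_max/box_is_max.
have -> : dia0 (range (@box L M)) = @dia L M.
  by apply: funext => a; exact/dia0_min/dia_is_min.
by case: M.
Qed.

End MLattice.

Theorem theorem3p4 (L : lattice_signature) (K : set (lattice_algebra L)) :
  [/\ set_bij (mclass K) (rc_pairs K) (@to_pair L),
      set_bij (rc_pairs K) (mclass K) (@of_pair L),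
      forall M : modal_structure L, mclass K M -> of_pair (to_pair M) = M
    & forall P : subset_pair L, rc_pairs K P -> to_pair (of_pair P) = P].
Proof.
have toP M : mclass K M -> rc_pairs K (to_pair M).
  move=> [KM mM]; split=> //.
    exact: subalgebra_range_box.
  exact: relatively_complete_range_box.
have ofP P : rc_pairs K P -> mclass K (of_pair P).
  by move=> [KP subP rcP]; split=> //; exact: is_mlattice_box0_dia0.
have toK M : mclass K M -> of_pair (to_pair M) = M.
  by move=> [_ mM]; exact: to_pairK.
have ofK P : rc_pairs K P -> to_pair (of_pair P) = P.
  (* Both pairs now visibly share the base [B], so only the subsets remain to be compared. *)
  case: P => B A0 [_ _ rcP].
  by rewrite /to_pair /of_pair /= range_box0.
by split=> //; [exact: set_bij_can toK ofK | exact: set_bij_can ofK toK].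
Qed.
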